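(* Let $B=\prod_{j=1}^d[0,\ell_j]\subset\mathbb R^d$ have positive integer side lengths $\ell_j$. Let $\mathcal C$ be a finite set of distinct corners of $B$, with nonnegative integer thresholds $t_c$ ($c\in\mathcal C$). Suppose that $$\|c-c'\|_1>t_c+t_{c'}\qquad\text{for all } c\ne c'\text{ in }\mathcal C .$$ Put $L_c(x)=\sum_{j=1}^d|x_j-c_j|$. If the polytope $$Q=\{x\in B: L_c(x)\ge t_c\text{ for all }c\in\mathcal C\}$$ is nonempty, then it is integral and has the integer decomposition property.
   Context: A corner of $B$ is a vertex of $B$, i.e. a point $c$ with each $c_j\in\{0,\ell_j\}$ (so each $L_c$ is affine on $B$ and $Q$ is a polytope). Integral means all vertices of $Q$ lie in $\mathbb Z^d$. The integer decomposition property (IDP) means: for every integer $k\ge1$, every $Z\in kQ\cap\mathbb Z^d$ is a sum of $k$ points of $Q\cap\mathbb Z^d$. *)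

(* Defs.v *)
From HB Require Import structures.
From mathcomp Require Import all_boot all_order all_algebra.
From mathcomp Require Import boolp classical_sets cardinality reals.

Set Implicit Arguments.
Unset Strict Implicit.
Unset Printing Implicit Defensive.

Import Order.TTheory GRing.Theory Num.Theory.

Local Open Scope classical_set_scope.
Local Open Scope ring_scope.

(* The norm that MathComp-Analysis puts on row vectors is the sup norm. *)
Definition l1norm (R : realType) (d : nat) (x : 'rV[R]_d) : R :=
  \sum_(j < d) `|x 0 j|.

Definition lattice (R : realType) (d : nat) : set 'rV[R]_d :=
  [set x | forall j, x 0 j \is a Num.int].

Definition box (R : realType) (d : nat) (l : 'I_d -> nat) : set 'rV[R]_d :=
  [set x | forall j, 0 <= x 0 j <= (l j)%:R].

Definition corner (R : realType) (d : nat) (l : 'I_d -> nat) : set 'rV[R]_d :=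
  [set c | forall j, c 0 j = 0 \/ c 0 j = (l j)%:R].

Definition corner_dist (R : realType) (d : nat) (c x : 'rV[R]_d) : R :=
  \sum_(j < d) `|x 0 j - c 0 j|.

Definition trimmed_box (R : realType) (d : nat) (l : 'I_d -> nat)
    (C : set 'rV[R]_d) (t : 'rV[R]_d -> nat) : set 'rV[R]_d :=
  [set x | box l x /\ forall c, C c -> (t c)%:R <= corner_dist c x].

(* The vertices of a polytope, taken as its extreme points. *)
Definition vertex (R : realType) (d : nat) (P : set 'rV[R]_d) : set 'rV[R]_d :=
  [set v | P v /\ forall (x y : 'rV[R]_d) (a : R), P x -> P y -> 0 < a < 1 ->
     v = a *: x + (1 - a) *: y -> x = v /\ y = v].

Definition integral_polytope (R : realType) (d : nat) (P : set 'rV[R]_d) : Prop :=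
  vertex P `<=` @lattice R d.

Definition dilate (R : realType) (d : nat) (k : nat) (P : set 'rV[R]_d) :
    set 'rV[R]_d :=
  [set k%:R *: x | x in P].

Definition has_IDP (R : realType) (d : nat) (P : set 'rV[R]_d) : Prop :=
  forall k : nat, (1 <= k)%N ->
  forall z : 'rV[R]_d, (dilate k P `&` @lattice R d) z ->
  exists p : 'I_k -> 'rV[R]_d,
    (forall i, (P `&` @lattice R d) (p i)) /\ z = \sum_(i < k) p i.

(* Main.v *)
Require Import Defs.
From HB Require Import structures.
From mathcomp Require Import all_boot all_order all_algebra.
From mathcomp Require Import boolp classical_sets cardinality reals.
From mathcomp Require Import zify ring lra.
Import Order.TTheory GRing.Theory Num.Theory.
Local Open Scope classical_set_scope.
Local Open Scope ring_scope.

(** Two facts carry the proof. First, on the box the distance to a corner [c]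
is an affine function of the point, each coordinate contributing [x j] or
[l j - x j]. Second, by the triangle inequality the separation hypothesis
gives [L_c x + L_c' x > t_c + t_c'] for distinct corners, so a point can
violate or attain the constraint of at most one corner
([at_most_one_near], [at_most_one_tight]).

Integrality. Suppose an extreme point [v] has a fractional coordinate [j0].
If no corner constraint is tight at [v], then [v] can be moved both ways along
coordinate [j0]. Otherwise exactly one is tight, and its value is an integer
sum of terms that are integers except at the fractional coordinates; hence
there is a second fractional coordinate [j1] ([tight_fractional_pair]), and
trading distance between [j0] and [j1] preserves the tight constraint. Both
moves stay in the polytope when they are short ([tangent_move]), against
extremality.

Integer decomposition. A lattice point [z] of the [k]-th dilate is a sum of
[k] lattice points of the box, which may lie too close to some corners. If a
summand [x] falls short of the threshold at a corner [S], then, since the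
distances to [S] add up to at least [k] times the threshold, another summand
[y] has a surplus there. Moving one unit of some coordinate between them
repairs [x] by one. The danger is that [y] comes too close to another corner
[S']. When [y] is already near [S'], comparing [x] and [y] on the coordinates
where [S] and [S'] differ shows that the unit can be taken there, which moves
[y] away from [S'] ([exchange_direction]). So the total shortage strictly
decreases ([exchange]), and repeating the exchange ends with all summands in
the polytope ([exists_feasible_family]).

Corners are encoded by the set [S] of coordinates at which they take the value
[l j], which makes the decomposition an argument about natural numbers. *)

(** * Exchanging units between lattice points of the box *)

Section Exchange.
Local Open Scope nat_scope.
Set Implicit Arguments.
Unset Strict Implicit.

Lemma sum_ltn_witness (J : finType) (P : pred J) (f g : J -> nat) :
  \sum_(j | P j) f j < \sum_(j | P j) g j -> exists2 j, P j & f j < g j.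
Proof.
move=> lt_fg; apply/exists_inP; apply/negP => /exists_inP no_j.
move: lt_fg; rewrite ltnNge => /negP; apply; apply: leq_sum => j Pj.
by rewrite leqNgt; apply/negP => lt_j; apply: no_j; exists j.
Qed.

Lemma sumD2 (I : finType) (i1 i2 : I) : i1 != i2 -> forall F : I -> nat,
  \sum_i F i = F i1 + F i2 + \sum_(i | (i != i1) && (i != i2)) F i.
Proof.
move=> ne12 F; rewrite (bigD1 i1) //= (bigD1 i2) /=; last by rewrite eq_sym.
by rewrite addnA.
Qed.

Variables (J : finType) (l : J -> nat).
Implicit Types (S : {set J}) (x y : J -> nat) (j : J).

Definition inbox x := forall j, x j <= l j.

(** Distance from [x] to the corner [S] along coordinate [j]. *)
Definition coord S x j := if j \in S then l j - x j else x j.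

Definition gap S x := \sum_j coord S x j.

(** One unit step away from the corner [S]; as the complement of [S] is the
opposite corner, [away (~: S)] is a step towards [S]. *)
Definition away S j x : J -> nat :=
  fun i => if i == j then (if j \in S then (x j).-1 else (x j).+1) else x i.

Definition differ S S' := [pred j | (j \in S) != (j \in S')].

Lemma coordC S x j : inbox x -> coord S x j + coord (~: S)%SET x j = l j.
Proof. by move=> /(_ j); rewrite /coord finset.in_setC; case: (j \in S) => /=; lia. Qed.

(** Distances to a corner depend on the coordinate sums only, because each is
affine on the box. *)
Lemma gap_sum (I : finType) S (r : I -> J -> nat) : (forall i, inbox (r i)) ->
  \sum_i gap S (r i) =
  \sum_j (if j \in S then #|I| * l j - \sum_i r i j else \sum_i r i j).
Proof.
move=> rl; rewrite /gap exchange_big /=; apply: eq_bigr => j _.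
rewrite /coord; case: (j \in S) => //.
by rewrite sumnB ?sum_nat_const // => i _; apply: rl.
Qed.

Lemma inbox_away S j x : inbox x -> coord S x j < l j -> inbox (away S j x).
Proof.
move=> xl; rewrite /coord /away => lt_j i; case: eqP => [->|_]; last exact: xl.
by move: (xl j) lt_j; case: (j \in S); lia.
Qed.

Lemma gap_away S S' j x : inbox x -> coord S x j < l j ->
  if differ S S' j then gap S' x = (gap S' (away S j x)).+1
  else gap S' (away S j x) = (gap S' x).+1.
Proof.
move=> xl lt_j.
have rest : \sum_(i | i != j) coord S' (away S j x) i =
            \sum_(i | i != j) coord S' x i.
  by apply: eq_bigr => i /negPf ne_ij; rewrite /coord /away ne_ij.
have split_j r : gap S' r = coord S' r j + \sum_(i | i != j) coord S' r i.
  by rewrite /gap (bigD1 j).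
rewrite !split_j rest.
move: (xl j) lt_j; rewrite /coord /away eqxx /=.
by case: (j \in S); case: (j \in S') => /=; lia.
Qed.

(** The triangle inequality through [x] between two corners, whose distance is
the sum of the sides along which they differ. *)
Lemma corner_dist_le_gap S S' x : inbox x ->
  \sum_(j | differ S S' j) l j <= gap S x + gap S' x.
Proof.
move=> xl; rewrite /gap -big_split /= big_mkcond /=; apply: leq_sum => j _.
by move: (xl j); rewrite /coord /=; case: (j \in S); case: (j \in S') => /=; lia.
Qed.

Variables (A : {set {set J}}) (T : {set J} -> nat).
Hypothesis separated : forall S S', S \in A -> S' \in A -> S != S' ->
  T S + T S' < \sum_(j | differ S S' j) l j.

Lemma at_most_one_near S S' x : S \in A -> S' \in A -> S != S' -> inbox x ->
  T S + T S' < gap S x + gap S' x.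
Proof.
move=> AS AS' ne xl.
exact: leq_trans (separated AS AS' ne) (corner_dist_le_gap S S' xl).
Qed.

Definition deficit S x := T S - gap S x.

(** Some coordinate has [y] farther from [S] than [x], since the total distance
is larger for [y]. If [y] is within its threshold of another corner [S'],
then on the sides where [S] and [S'] differ [x] still accumulates less than
[T S], whereas [y] accumulates at least their total length minus [T S'],
which exceeds [T S]; so such a coordinate can be chosen among them, where a
step towards [S] is a step away from [S']. *)
Lemma exchange_direction S x y :
  S \in A -> inbox x -> inbox y -> gap S x < T S -> T S < gap S y ->
  exists2 j, coord S x j < coord S y j &
    forall S', S' \in A -> S' != S -> gap S' y <= T S' -> differ S S' j.
Proof.
move=> AS xl yl ltx lty.
case: (boolP [exists S' in A, (S' != S) && (gap S' y <= T S')]); last first.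
  move=> no_near.
  have [j _ lt_j] := sum_ltn_witness (ltn_trans ltx lty).
  exists j => // S' AS' ne near; case/negP: no_near.
  by apply/exists_inP; exists S' => //; rewrite ne near.
case/exists_inP=> S' AS' /andP[ne near].
have neS : S != S' by rewrite eq_sym.
have sep := separated AS AS' neS.
have Ey : \sum_(j | differ S S' j) coord S y j +
          \sum_(j | differ S S' j) coord S' y j = \sum_(j | differ S S' j) l j.
  rewrite -big_split /=; apply: eq_bigr => j.
  move: (yl j); rewrite /coord /=.
  by case: (j \in S); case: (j \in S') => //=; lia.
have sub_le U w : \sum_(j | differ S S' j) coord U w j <= gap U w.
  by rewrite /gap [leqRHS](bigID (differ S S')) /= leq_addr.
have := sub_le S x; have := sub_le S' y => le1 le2.
have lt_xy : \sum_(j | differ S S' j) coord S x j <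
             \sum_(j | differ S S' j) coord S y j by lia.
have [j dj lt_j] := sum_ltn_witness lt_xy.
exists j => // S'' AS'' ne'' near''.
(* [y] being near [S'], no third corner is near it. *)
have [->//|ne'] := eqVneq S'' S'.
by have := at_most_one_near AS'' AS' ne' yl; lia.
Qed.

(** The step repairs [x] at [S] and creates no shortage elsewhere: [x] ends
within the threshold of [S], hence beyond every other one, and [y] recedes
from each other corner that it was near. *)
Lemma exchange S x y :
  S \in A -> inbox x -> inbox y -> gap S x < T S -> T S < gap S y ->
  exists x' y', [/\ inbox x', inbox y',
    forall j, x' j + y' j = x j + y j,
    deficit S x' + deficit S y' < deficit S x + deficit S y &
    forall S', S' \in A ->
      deficit S' x' + deficit S' y' <= deficit S' x + deficit S' y].
Proof.
move=> AS xl yl ltx lty.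
have [j lt_j dir] := exchange_direction AS xl yl ltx lty.
have ltxj : coord S x j < l j by have := coordC S j yl; lia.
have ltyj : coord (~: S)%SET y j < l j by have := coordC S j yl; lia.
have x'l := inbox_away xl ltxj; have y'l := inbox_away yl ltyj.
have gx S' := gap_away S' xl ltxj; have gy S' := gap_away S' yl ltyj.
have [ex ey] : gap S (away S j x) = (gap S x).+1 /\
               gap S y = (gap S (away (~: S)%SET j y)).+1.
  by move: (gx S) (gy S); rewrite /= finset.in_setC; case: (j \in S).
have strict : deficit S (away S j x) + deficit S (away (~: S)%SET j y) <
              deficit S x + deficit S y by rewrite /deficit; lia.
exists (away S j x), (away (~: S)%SET j y); split => //.
  move=> i; rewrite /away; case: eqP => [->|//]; rewrite finset.in_setC.
  by move: (xl j) (yl j) lt_j; rewrite /coord; case: (j \in S) => /=; lia.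
move=> S' AS'; have [->|ne] := eqVneq S' S; first exact: ltnW.
have := at_most_one_near AS' AS ne x'l.
have := dir S' AS' ne.
move: (gy S'); rewrite /deficit /= finset.in_setC.
by case: (j \in S); case: (j \in S') => /= => ? ?; lia.
Qed.

(** Induction on the total deficit: a short summand forces, by the average
hypothesis, one with a surplus at the same corner, and an exchange between
the two lowers the total while keeping coordinate sums. *)
Lemma exists_feasible_family (I : finType) (p : I -> J -> nat) :
  (forall i, inbox (p i)) ->
  (forall S, S \in A -> #|I| * T S <= \sum_i gap S (p i)) ->
  exists q : I -> J -> nat, [/\ forall i, inbox (q i),
    forall j, \sum_i q i j = \sum_i p i j &
    forall i S, S \in A -> T S <= gap S (q i)].
Proof.
have [n] := ubnP (\sum_i \sum_(S in A) deficit S (p i)).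
elim: n p => // n IHn p lt_n pl avg.
case: (boolP [exists i, [exists S in A, gap S (p i) < T S]]); last first.
  move=> ok; exists p; split=> // i S AS; rewrite leqNgt; apply/negP => bad.
  case/negP: ok; apply/existsP; exists i; apply/exists_inP.
  by exists S.
case/existsP=> i1 /exists_inP[S AS bad].
have [i2 surplus] : exists i2, T S < gap S (p i2).
  apply/existsP; apply/negP => /existsP none.
  have le_i i : gap S (p i) <= T S.
    by rewrite leqNgt; apply/negP => ?; apply: none; exists i.
  have : \sum_i gap S (p i) < #|I| * T S.
    rewrite -sum_nat_const (bigD1 i1) //= [ltnRHS](bigD1 i1) //= -addSn.
    by apply: leq_add => //; apply: leq_sum.
  by have := avg S AS; lia.
have ne12 : i1 != i2 by apply: contraTneq surplus => <-; lia.
have [x' [y' [x'l y'l sum_eq lt_def le_def]]] :=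
  exchange AS (pl i1) (pl i2) bad surplus.
pose p' i := if i == i1 then x' else if i == i2 then y' else p i.
have p'1 : p' i1 = x' by rewrite /p' eqxx.
have p'2 : p' i2 = y' by rewrite /p' eq_sym (negPf ne12) eqxx.
have p'o i : (i != i1) && (i != i2) -> p' i = p i.
  by case/andP=> /negPf h1 /negPf h2; rewrite /p' h1 h2.
have p'l i : inbox (p' i) by rewrite /p'; case: eqP => // _; case: eqP.
have p'sum j : \sum_i p' i j = \sum_i p i j.
  rewrite !(sumD2 ne12) p'1 p'2 sum_eq.
  by congr (_ + _); apply: eq_bigr => i /p'o ->.
have [||q [ql qsum qok]] := IHn p' _ p'l.
- rewrite ltnS in lt_n; apply: leq_trans lt_n.
  rewrite exchange_big [ltnRHS]exchange_big /=.
  have rw S' r : \sum_i deficit S' (r i) = deficit S' (r i1) + deficit S' (r i2) +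
      \sum_(i | (i != i1) && (i != i2)) deficit S' (r i) by exact: sumD2.
  have rest S' : \sum_(i | (i != i1) && (i != i2)) deficit S' (p' i) =
                 \sum_(i | (i != i1) && (i != i2)) deficit S' (p i).
    by apply: eq_bigr => i /p'o ->.
  rewrite (bigD1 S) //= [ltnRHS](bigD1 S) //= -addSn; apply: leq_add.
    by rewrite !rw rest p'1 p'2 -addSn leq_add2r.
  apply: leq_sum => S' /andP[AS' _].
  by rewrite !rw rest p'1 p'2 leq_add2r le_def.
- move=> S' AS'; rewrite (leq_trans (avg S' AS')) // !gap_sum //.
  by apply: leq_sum => j _; rewrite p'sum.
exists q; split=> // j; by rewrite qsum p'sum.
Qed.

Lemma greedy_sum (k a m : nat) : \sum_(i < k) minn a (m - i * a) = minn (k * a) m.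
Proof.
elim: k => [|k IHk]; first by rewrite big_ord0; lia.
rewrite big_ord_recr /= IHk mulSn; lia.
Qed.

(** The greedy filling of the summands, coordinate by coordinate, is the
starting family to be repaired. *)
Lemma integer_decomposition (k : nat) (m : J -> nat) :
  (forall j, m j <= k * l j) ->
  (forall S, S \in A -> k * T S <=
     \sum_j (if j \in S then k * l j - m j else m j)) ->
  exists q : 'I_k -> J -> nat, [/\ forall i, inbox (q i),
    forall j, \sum_i q i j = m j &
    forall i S, S \in A -> T S <= gap S (q i)].
Proof.
move=> ml avg; pose p (i : 'I_k) j := minn (l j) (m j - i * l j).
have pl i : inbox (p i) by move=> j; rewrite geq_minl.
have psum j : \sum_i p i j = m j by rewrite greedy_sum; apply/minn_idPr.
have [S AS|q [ql qsum qok]] := exists_feasible_family pl.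
  rewrite gap_sum // card_ord (leq_trans (avg S AS)) //.
  by apply: leq_sum => j _; rewrite psum.
by exists q; split=> // j; rewrite qsum.
Qed.

End Exchange.

(** * The trimmed box *)

Section Polytope.
Set Implicit Arguments.
Unset Strict Implicit.

Variables (R : realType) (d : nat) (l : 'I_d -> nat).
Implicit Types (S : {set 'I_d}) (x v w : 'rV[R]_d).

Definition corner_of S : 'rV[R]_d := \row_j (if j \in S then (l j)%:R else 0).

Lemma corner_ofP c : corner l c -> exists S, c = corner_of S.
Proof.
move=> cc; exists [set j | c 0 j == (l j)%:R]%SET.
apply/rowP => j; rewrite mxE inE; case: eqP => // ne.
by case: (cc j).
Qed.

Lemma corner_dist_box S x : box l x ->
  corner_dist (corner_of S) x =
  \sum_j (if j \in S then (l j)%:R - x 0 j else x 0 j).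
Proof.
move=> xl; apply: eq_bigr => j _; have /andP[x0 x1] := xl j.
rewrite mxE; case: ifP => _; last by rewrite subr0 ger0_norm.
by rewrite distrC ger0_norm // subr_ge0.
Qed.

Lemma corner_dist_natrow S (q : 'I_d -> nat) : inbox l q ->
  corner_dist (corner_of S) (\row_j (q j)%:R) = (gap l S q)%:R.
Proof.
move=> ql; rewrite corner_dist_box; last first.
  by move=> j; rewrite mxE ler0n ler_nat ql.
rewrite natr_sum; apply: eq_bigr => j _; rewrite mxE /coord.
by case: ifP => // _; rewrite natrB.
Qed.

Lemma l1norm_corner_ofB S S' :
  l1norm (corner_of S - corner_of S') = (\sum_(j | differ S S' j) l j)%:R.
Proof.
rewrite natr_sum [RHS]big_mkcond /=; apply: eq_bigr => j _; rewrite !mxE.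
by case: (j \in S); case: (j \in S');
  rewrite /= ?subrr ?subr0 ?sub0r ?normrN ?normr0 ?normr_nat.
Qed.

Variables (C : set 'rV[R]_d) (t : 'rV[R]_d -> nat).
Hypothesis l_gt0 : forall j, (0 < l j)%N.
Hypothesis C_corner : C `<=` corner l.
Hypothesis C_sep : forall c c' : 'rV[R]_d, C c -> C c' -> c <> c' ->
  (t c + t c')%:R < l1norm (c - c').

Local Notation Q := (trimmed_box l C t).

Definition cut_corners : {set {set 'I_d}} :=
  [set S | `[< C (corner_of S) >]]%SET.

Local Notation A := cut_corners.
Local Notation T := (fun S => t (corner_of S)).

Lemma cut_cornersP S : reflect (C (corner_of S)) (S \in A).
Proof. by rewrite inE; apply: asboolP. Qed.

Lemma trimmed_boxP x :
  Q x <-> box l x /\ forall S, S \in A -> (T S)%:R <= corner_dist (corner_of S) x.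
Proof.
split=> -[xl xC]; split=> //; first by move=> S /cut_cornersP; apply: xC.
by move=> c Cc; have [S e] := corner_ofP (C_corner Cc); subst c;
  apply: xC; apply/cut_cornersP.
Qed.

Lemma cut_corners_sep S S' : S \in A -> S' \in A -> S != S' ->
  (T S + T S')%:R < l1norm (corner_of S - corner_of S').
Proof.
move=> /cut_cornersP CS /cut_cornersP CS' ne; apply: C_sep => // eS.
case/eqP: ne; apply/setP => j; move/rowP/(_ j): eS; rewrite !mxE.
have /lt0r_neq0/eqP nz : 0 < (l j)%:R :> R by rewrite ltr0n.
by case: (j \in S); case: (j \in S') => // e; case: nz.
Qed.

Lemma at_most_one_tight S S' x : S \in A -> S' \in A ->
  corner_dist (corner_of S) x = (T S)%:R ->
  corner_dist (corner_of S') x = (T S')%:R -> S = S'.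
Proof.
move=> AS AS' tS tS'; apply/eqP/negP => /negP ne.
have := cut_corners_sep AS AS' ne; rewrite natrD -tS -tS' ltNge => /negP; apply.
rewrite -big_split; apply: ler_sum => j _; rewrite !mxE /=.
by rewrite [in leRHS]distrC; apply: ler_distD.
Qed.

(** As distances are affine, scaling the constraint at [x] by [k] is the
average hypothesis of [integer_decomposition] for the point [k *: x]. *)
Lemma trimmed_box_IDP : has_IDP Q.
Proof.
move=> k k_gt0 z [[x Qx <-{z}] zint]; have [xl xC] := (trimmed_boxP x).1 Qx.
pose m j := Num.truncn ((k%:R *: x) 0 j).
have zE j : (m j)%:R = k%:R * x 0 j.
  have := zint j; rewrite /m mxE => zj; apply/eqP.
  rewrite -natrEtruncn natrEint zj mulr_ge0 ?ler0n //.
  by case/andP: (xl j).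
have ml j : (m j <= k * l j)%N.
  rewrite -(ler_nat R) zE natrM ler_wpM2l ?ler0n //.
  by case/andP: (xl j).
have sep S S' : S \in A -> S' \in A -> S != S' ->
    (T S + T S' < \sum_(j | differ S S' j) l j)%N.
  move=> AS AS' ne; rewrite -(ltr_nat R) -l1norm_corner_ofB.
  exact: cut_corners_sep.
have [|q [ql qsum qok]] := integer_decomposition sep ml.
  move=> S AS; rewrite -(ler_nat R) natrM natr_sum.
  rewrite (le_trans (ler_wpM2l (ler0n _ _) (xC S AS))) //.
  rewrite corner_dist_box // mulr_sumr; apply: ler_sum => j _.
  by case: ifP => _; rewrite ?natrB // ?natrM zE // mulrBr.
exists (fun i => \row_j (q i j)%:R); split=> [i|].
  split; last by move=> j; rewrite mxE natr_int.
  apply/trimmed_boxP; split=> [j|S AS]; first by rewrite mxE ler0n ler_nat ql.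
  by rewrite corner_dist_natrow // ler_nat qok.
apply/rowP => j; rewrite mxE summxE -zE -qsum natr_sum.
by apply: eq_bigr => i _; rewrite mxE.
Qed.

Lemma common_positive_bound (I : finType) (f : I -> R) :
  exists2 e, 0 < e & forall i, 0 < f i -> e <= f i.
Proof.
exists (\big[Num.min/1]_(i | 0 < f i) f i); first by apply: lt_bigmin => //; apply: ltr01.
by move=> i fi; apply: bigmin_le_cond.
Qed.

(** The linear part of the affine function that gives, on the box, the distance
to the corner [S]. *)
Definition slope S w : R := \sum_j (if j \in S then - w 0 j else w 0 j).

Lemma corner_dist_slope S v w : box l v -> box l (v + w) ->
  corner_dist (corner_of S) (v + w) = corner_dist (corner_of S) v + slope S w.
Proof.
move=> vl vwl; rewrite !corner_dist_box // -big_split /=.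
by apply: eq_bigr => j _; rewrite mxE; case: ifP => _ //; rewrite opprD addrA.
Qed.

Lemma slope_ge S w : - l1norm w <= slope S w.
Proof.
rewrite lerNl -sumrN; apply: ler_sum => j _.
by case: ifP => _; rewrite ?opprK ?ler_norm // -normrN ler_norm.
Qed.

Lemma slopeZ S (a : R) w : slope S (a *: w) = a * slope S w.
Proof.
by rewrite mulr_sumr; apply: eq_bigr => j _; rewrite mxE; case: ifP; rewrite ?mulrN.
Qed.

(** Directions along which [v] can be moved both ways. An integral coordinate
may lie on a facet of the box, so it is kept fixed. *)
Definition tangent v w :=
  (forall j, v 0 j \is a Num.int -> w 0 j = 0) /\
  (forall S, S \in A -> corner_dist (corner_of S) v = (T S)%:R -> slope S w = 0).

(** The constraints that are tight at [v] are constant along a tangent direction,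
and each of the finitely many others has a positive slack, which a move of
smaller length cannot exhaust. *)
Lemma tangent_move v : Q v ->
  exists2 e, 0 < e & forall w, tangent v w -> l1norm w <= e -> Q (v + w).
Proof.
case/trimmed_boxP=> vl vA.
have [e1 e1_gt0 le_e1] := common_positive_bound (fun j => v 0 j).
have [e2 e2_gt0 le_e2] := common_positive_bound (fun j => (l j)%:R - v 0 j).
have [e3 e3_gt0 le_e3] := common_positive_bound
  (fun S => corner_dist (corner_of S) v - (T S)%:R).
exists (Num.min e1 (Num.min e2 e3)); first by rewrite !lt_min e1_gt0 e2_gt0.
move=> w [w_int w_tight]; rewrite !le_min => /and3P[we1 we2 we3].
have w_le j : `|w 0 j| <= l1norm w.
  by rewrite /l1norm (bigD1 j) //= lerDl sumr_ge0.
have vwl : box l (v + w).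
  move=> j; rewrite mxE; have /andP[v0 v1] := vl j.
  have := w_int j; have [_ ->//|nint _] := boolP (v 0 j \is a Num.int).
    by rewrite addr0 v0.
  have := le_e2 j; have := le_e1 j.
  rewrite subr_gt0 !lt_neqAle v0 v1 !andbT.
  have -> : v 0 j != (l j)%:R by apply: contraNneq nint => ->; rewrite natr_int.
  have -> : 0 != v 0 j by apply: contraNneq nint => <-; rewrite rpred0.
  move=> /(_ isT) le1 /(_ isT) le2.
  by have := w_le j; rewrite ler_norml => /andP[]; lra.
apply/trimmed_boxP; split=> // S AS; rewrite corner_dist_slope //.
have := vA S AS; rewrite le_eqVlt => /predU1P[tight|far].
  by rewrite w_tight ?addr0 // -tight.
have := le_e3 S; rewrite subr_gt0 => /(_ far).
by have := slope_ge S w; lra.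
Qed.

(** Otherwise [v] would be the midpoint of two points of the polytope, its short
translates by opposite multiples of [w]. *)
Lemma vertex_rigid v w : vertex Q v -> tangent v w -> w = 0.
Proof.
move=> [Qv ext] tw; have [e e_gt0 move_ok] := tangent_move Qv.
(* The step [e / M] makes the length of the move at most [e]; the added 1
avoids a division by zero. *)
pose M := 1 + l1norm w.
have w_ge0 : 0 <= l1norm w by apply: sumr_ge0 => j _; apply: normr_ge0.
have M_gt0 : 0 < M by rewrite ltr_wpDr.
have tangentZ a : tangent v (a *: w).
  case: tw => w_int w_tight; split=> [j /w_int e0|S AS /(w_tight S AS) e0].
    by rewrite mxE e0 mulr0.
  by rewrite slopeZ e0 mulr0.
have small a : `|a| = e / M -> Q (v + a *: w).
  move=> aE; apply: move_ok => //.
  have -> : l1norm (a *: w) = e / M * l1norm w.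
    by rewrite mulr_sumr; apply: eq_bigr => j _; rewrite mxE normrM aE.
  by rewrite mulrAC ler_pdivrMr // ler_pM2l // /M lerDr.
pose a := e / M; have a_gt0 : 0 < a by rewrite divr_gt0.
have Qp := small a (gtr0_norm a_gt0).
have Qm := small (- a) (etrans (normrN _) (gtr0_norm a_gt0)).
have half : 0 < (2^-1 : R) < 1 by apply/andP; split; lra.
have [|/eqP] := ext _ _ _ Qp Qm half.
  by apply/rowP => j; rewrite !mxE; field.
rewrite -[X in _ == X]addr0 (inj_eq (addrI v)) scaler_eq0 gt_eqF //=.
by move/eqP.
Qed.

(** If the other coordinates were integral, the equation of the tight constraint
would express [v 0 j0] as an integer. *)
Lemma tight_fractional_pair S v j0 : box l v ->
  corner_dist (corner_of S) v = (T S)%:R -> v 0 j0 \isn't a Num.int ->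
  exists2 j1, j1 != j0 & v 0 j1 \isn't a Num.int.
Proof.
move=> vl tight nint0.
have [/existsP[j1 /andP[]]|none] :=
    boolP [exists j, (j != j0) && (v 0 j \isn't a Num.int)]; first by exists j1.
case/negP: nint0; move: tight; rewrite corner_dist_box // (bigD1 j0) //=.
set s := \sum_(i | _) _ => tight.
have s_int : s \is a Num.int.
  apply: rpred_sum => j ne; have vj : v 0 j \is a Num.int.
    by apply/negPn/negP => nj; case/negP: none; apply/existsP; exists j; rewrite ne.
  by case: ifP => _ //; rewrite rpredB // natr_int.
move/(canRL (addrK s)): tight; case: ifP => _ e.
  have -> : v 0 j0 = (l j0)%:R - ((T S)%:R - s) by rewrite -e opprB addrC subrK.
  by rewrite !rpredB // natr_int.
by rewrite e rpredB // natr_int.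
Qed.

(** A fractional coordinate of a vertex yields a nonzero tangent direction:
a coordinate direction if no corner is tight, and otherwise a trade between
two fractional coordinates, which suffices because a single corner is tight. *)
Lemma trimmed_box_integral : integral_polytope Q.
Proof.
move=> v vtx j0; apply/negPn/negP => nint0.
have [Qv _] := vtx; have [vl vA] := (trimmed_boxP v).1 Qv.
case: (boolP [exists S in A, corner_dist (corner_of S) v == (T S)%:R]); last first.
  move=> loose; have /vertex_rigid : tangent v (delta_mx 0 j0).
    split=> [j vj|S AS tight].
      by rewrite mxE eqxx /=; case: eqP => // e; rewrite -e vj in nint0.
    by case/negP: loose; apply/exists_inP; exists S => //; apply/eqP.
  move/(_ vtx)/rowP/(_ j0); rewrite !mxE !eqxx => /eqP.
  by rewrite oner_eq0.
case/exists_inP=> S AS /eqP tight.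
have [j1 ne10 nint1] := tight_fractional_pair vl tight nint0.
pose s j : R := if j \in S then -1 else 1.
have s2 j : s j * s j = 1 by rewrite /s; case: ifP; rewrite ?mulrNN mulr1.
(* One unit away from [S] along [j0] and one unit back along [j1]. *)
pose w : 'rV[R]_d := s j0 *: delta_mx 0 j0 - s j1 *: delta_mx 0 j1.
have wE j : w 0 j = s j0 * (j == j0)%:R - s j1 * (j == j1)%:R by rewrite !mxE.
have slopeE : slope S w = 0.
  have -> : slope S w = \sum_j s j * w 0 j.
    by apply: eq_bigr => j _; rewrite /s; case: ifP; rewrite ?mulN1r ?mul1r.
  rewrite (bigD1 j0) //= (bigD1 j1) //= big1 => [|j /andP[n0 n1]].
    rewrite !wE !eqxx (negPf ne10) [j0 == j1]eq_sym (negPf ne10).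
    by rewrite !mulr0 !mulr1 subr0 sub0r mulrN !s2 addr0 subrr.
  by rewrite wE (negPf n0) (negPf n1) !mulr0 subrr mulr0.
have /(vertex_rigid vtx)/rowP/(_ j0) : tangent v w.
  split=> [j vj|S' AS' tight'].
    rewrite wE; case: eqP => [e|_]; first by rewrite -e vj in nint0.
    case: eqP => [e|_]; first by rewrite -e vj in nint1.
    by rewrite !mulr0 subrr.
  by rewrite -(at_most_one_tight AS AS' tight tight').
rewrite wE mxE eqxx eq_sym (negPf ne10) mulr0 subr0 mulr1 => s0.
by have /eqP := s2 j0; rewrite s0 mul0r eq_sym oner_eq0.
Qed.

End Polytope.

Theorem theorem3p1 (R : realType) (d : nat) (l : 'I_d -> nat)
    (C : set 'rV[R]_d) (t : 'rV[R]_d -> nat)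
    (l_gt0 : forall j, (0 < l j)%N)
    (C_fin : finite_set C)
    (C_corner : C `<=` corner l)
    (C_sep : forall c c' : 'rV[R]_d, C c -> C c' -> c <> c' ->
       (t c + t c')%:R < l1norm (c - c')) :
  trimmed_box l C t !=set0 ->
  integral_polytope (trimmed_box l C t) /\ has_IDP (trimmed_box l C t).
Proof.
by split; [exact: trimmed_box_integral | exact: trimmed_box_IDP].
Qed.
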